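(* Let $(M,\varphi)$ be a $7$-manifold with a $G_2$-structure, $H$ an associative distribution on $M$, and $(\Sigma,g_\Sigma)$ a $3$-dimensional oriented Riemannian manifold. Let $\iota:(\Sigma,g_\Sigma)\to M$ be a positive horizontally projectable immersion such that $\iota_*^H:(T\Sigma,g_\Sigma)\to(\iota^*H,g|_H)$ is an isometry. Then $\iota$ is Fueter (with respect to the canonical identification $\mathcal I=\iota_*^H$) if and only if it is adiabatic calibrated.
   Context: On $\mathbb R^7$ let $\varphi_0=dx_{123}+dx_{145}+dx_{167}+dx_{246}-dx_{257}-dx_{347}-dx_{356}$. A $G_2$-structure on a 7-manifold $M$ is a $3$-form $\varphi$ pointwise identified with $\varphi_0$ by linear isomorphisms $T_xM\to\mathbb R^7$; these transport the standard metric and orientation to a metric $g$ and orientation on $M$. An oriented $3$-plane $\pi$ is associative if $\varphi|_\pi=\mathrm{vol}_\pi$. An associative distribution is a 3-dimensional distribution $H$ such that each $H_x$, suitably oriented, is associative; $H$ is given this orientation. Let $V=H^\perp$, with projections $p_H,p_V$ from $TM=H\oplus V$. Then $\varphi=\underline\lambda+\underline\omega$, with $\underline\lambda$ the volume form of $H$ (extended by zero on $V$) and $\underline\omega\in\Gamma(H^*\otimes\Lambda^2V^* )$. For $\iota:\Sigma\to M$, $\iota_*^H=p_H\circ\iota_*$, $\iota_*^V=p_V\circ\iota_*$. An immersion $\iota$ is positive horizontally projectable if $\iota_*^H:T_\sigma\Sigma\to H_{\iota(\sigma)}$ is an orientation-preserving isomorphism for all $\sigma$. For such $\iota$ and $\pi=\iota_*(T_\sigma\Sigma)$,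 let $g^H_\pi=(p_H|_\pi)^*g$, $\mathrm{vol}^H_\pi$ its volume form on the oriented space $\pi$, $ve(\pi)=\frac12\sum_i|p_V(v_i)|^2$ for a $g^H_\pi$-orthonormal basis $\{v_i\}$. $\iota$ is adiabatic calibrated if $\underline\omega|_\pi=ve(\pi)\mathrm{vol}^H_\pi$ for all its tangent planes $\pi$. For a unit vector $h\in H_x$, $J_h$ is the complex structure on $V_x$ defined by $g(J_h\cdot,\cdot)|_{V_x}=\varphi(h,\cdot,\cdot)|_{V_x}$. Given a map $\iota:\Sigma\to M$ and an orientation-preserving fiberwise isometry $\mathcal I:(T\Sigma,g_\Sigma)\to(\iota^*H,g|_H)$, a positive $g_\Sigma$-orthonormal basis $\{e_1,e_2,e_3\}$ of $T_\sigma\Sigma$ gives complex structures $J_i:=J_{\mathcal I(e_i)}$ on $V_{\iota(\sigma)}$; the Fueter operator is $\mathcal F_{\mathcal I}(\iota)=\sum_{i=1}^3J_i(\iota_*^V(e_i))$ (independent of the basis), and $\iota$ is a Fueter map if $\mathcal F_{\mathcal I}(\iota)=0$. When $\iota_*^H$ is an isometry, the canonical choice $\mathcal I(v)=\iota^H_*(v)$ is used. *)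

(* Defs.v *)
From HB Require Import structures.
From mathcomp Require Import all_boot all_order all_algebra.
From mathcomp Require Import all_classical all_reals all_analysis.

Set Implicit Arguments.
Unset Strict Implicit.
Unset Printing Implicit Defensive.

Import Order.TTheory GRing.Theory Num.Theory.
Import numFieldNormedType.Exports.

Local Open Scope classical_set_scope.
Local Open Scope ring_scope.

(** * Smooth manifolds *)

(* [D] is meant to be open. *)
Fixpoint Ck_on {R : realType} {n : nat} {W : normedModType R} (k : nat)
    (D : set 'rV[R]_n) (f : 'rV[R]_n -> W) : Prop :=
  match k with
  | 0 => forall y, D y -> {for y, continuous f}
  | k'.+1 => (forall y, D y -> differentiable f y) /\
             forall v : 'rV[R]_n, Ck_on k' D ('D_v f)
  end.

Definition smooth_on {R : realType} {n : nat} {W : normedModType R}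
    (D : set 'rV[R]_n) (f : 'rV[R]_n -> W) : Prop := forall k, Ck_on k D f.

(* The maps are total; only their values on [chart_dom], resp. [chart_cod],
   are meaningful. *)
Record chart (R : realType) (n : nat) (T : topologicalType) := Chart {
  chart_dom : set T;
  chart_cod : set 'rV[R]_n;
  chart_map :> T -> 'rV[R]_n;
  chart_inv : 'rV[R]_n -> T;
  chart_dom_open : open chart_dom;
  chart_cod_open : open chart_cod;
  chart_map_cod : forall x, chart_dom x -> chart_cod (chart_map x);
  chart_inv_dom : forall y, chart_cod y -> chart_dom (chart_inv y);
  chart_mapK : forall x, chart_dom x -> chart_inv (chart_map x) = x;
  chart_invK : forall y, chart_cod y -> chart_map (chart_inv y) = y;
  chart_map_continuous : {within chart_dom, continuous chart_map};
  chart_inv_continuous : {within chart_cod, continuous chart_inv} }.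

Definition smooth_transition {R : realType} {n : nat} {T : topologicalType}
    (c d : chart R n T) : Prop :=
  smooth_on [set y | chart_cod c y /\ chart_dom d (chart_inv c y)]
    (d \o chart_inv c).

(* The atlas need not be maximal.  [chart_at x] is a preferred chart around
   [x], used only to represent the tangent space at [x] (see [tangent]). *)
Record manifold (R : realType) (n : nat) := Manifold {
  carrier :> topologicalType;
  carrier_hausdorff : hausdorff_space carrier;
  carrier_second_countable : @second_countable carrier;
  atlas : set (chart R n carrier);
  chart_at : carrier -> chart R n carrier;
  atlas_compatible : forall c d, atlas c -> atlas d -> smooth_transition c d;
  chart_at_atlas : forall x, atlas (chart_at x);
  chart_at_dom : forall x, chart_dom (chart_at x) x }.

(* A tangent vector at [x] is represented by its components in the preferred
   chart at [x]; its components in another chart are given by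
   [tangent_to_chart]. *)
Definition tangent {R : realType} {n : nat} {M : manifold R n} (x : M) :
  vectType R := 'rV[R]_n.

Definition tangent_to_chart {R : realType} {n : nat} {M : manifold R n}
    (c : chart R n M) (x : M) (v : tangent x) : 'rV[R]_n :=
  'd (c \o chart_inv (chart_at x)) (chart_at x x) v.

(* The tangent vector at [chart_inv c y] with components [v] in the chart
   [c]. *)
Definition tangent_of_chart {R : realType} {n : nat} {M : manifold R n}
    (c : chart R n M) (y : 'rV[R]_n) (v : 'rV[R]_n) :
    tangent (chart_inv c y : M) :=
  'd (chart_at (chart_inv c y : M) \o chart_inv c) y v.

Definition smooth_vector_field_on {R : realType} {n : nat} {M : manifold R n}
    (U : set M) (X : forall x : M, tangent x) : Prop :=
  forall c, atlas c ->
    smooth_on [set y | chart_cod c y /\ U (chart_inv c y)]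
      (fun y => tangent_to_chart c (X (chart_inv c y))).

Definition smooth_map {R : realType} {m n : nat} {S : manifold R m}
    {M : manifold R n} (f : S -> M) : Prop :=
  continuous f /\
  forall (c : chart R m S) (d : chart R n M), atlas c -> atlas d ->
    smooth_on [set y | chart_cod c y /\ chart_dom d (f (chart_inv c y))]
      (d \o f \o chart_inv c).

Definition tangent_map {R : realType} {m n : nat} {S : manifold R m}
    {M : manifold R n} (f : S -> M) (s : S) : {linear tangent s -> tangent (f s)} :=
  'd (chart_at (f s) \o f \o chart_inv (chart_at s)) (chart_at s s).

Definition immersion {R : realType} {m n : nat} {S : manifold R m}
    {M : manifold R n} (f : S -> M) : Prop :=
  smooth_map f /\ forall s, injective (tangent_map f s).

Definition smooth_2tensor {R : realType} {n : nat} {M : manifold R n}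
    (g : forall x : M, tangent x -> tangent x -> R) : Prop :=
  forall (c : chart R n M) (u v : 'rV[R]_n), atlas c ->
    smooth_on (chart_cod c)
      (fun y => g _ (tangent_of_chart c y u) (tangent_of_chart c y v) : R^o).

Definition smooth_3tensor {R : realType} {n : nat} {M : manifold R n}
    (phi : forall x : M, tangent x -> tangent x -> tangent x -> R) : Prop :=
  forall (c : chart R n M) (u v w : 'rV[R]_n), atlas c ->
    smooth_on (chart_cod c)
      (fun y => phi _ (tangent_of_chart c y u) (tangent_of_chart c y v)
                      (tangent_of_chart c y w) : R^o).

Record riemannian_metric (R : realType) (n : nat) (M : manifold R n) :=
  RiemannianMetric {
  metric_at :> forall x : M, tangent x -> tangent x -> R;
  metric_linear : forall x (v : tangent x),
    linear (fun u => metric_at u v : R^o);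
  metric_sym : forall x (u v : tangent x), metric_at u v = metric_at v u;
  metric_posdef : forall x (u : tangent x), u != 0 -> 0 < metric_at u u;
  metric_smooth : smooth_2tensor metric_at }.

(** * Orientations and volume forms of subspaces *)

(* All ordered families obtained from [e] by a change of basis of positive
   determinant. *)
Definition orientation_class {R : realType} {V : vectType R} {n : nat}
    (e : n.-tuple V) : set (n.-tuple V) :=
  [set f | exists P : 'M[R]_n, 0 < \det P /\
     forall i, tnth f i = \sum_j P i j *: tnth e j].

(* An orientation of [W] is given by the set of its positive bases. *)
Definition is_orientation {R : realType} {V : vectType R} {n : nat}
    (W : {vspace V}) (o : set (n.-tuple V)) : Prop :=
  exists2 e : n.-tuple V, basis_of W e & o = orientation_class e.

Definition orthonormal_family {R : realType} {V : vectType R} {n : nat}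
    (g : V -> V -> R) (e : n.-tuple V) : Prop :=
  forall i j, g (tnth e i) (tnth e j) = (i == j)%:R.

(* The choice of the basis is irrelevant. *)
Definition positive_onb {R : realType} {V : vectType R} {n : nat}
    (g : V -> V -> R) (o : set (n.-tuple V)) : n.-tuple V :=
  xget (nseq_tuple n 0) [set e | o e /\ orthonormal_family g e].

(* The volume form of a 3-dimensional inner product space oriented by [o]. *)
Definition volume_form {R : realType} {V : vectType R}
    (g : V -> V -> R) (o : set (3.-tuple V)) (u v w : V) : R :=
  \det (\matrix_(i < 3, j < 3)
          g (tnth (positive_onb g o) i) (tnth [tuple u; v; w] j)).

(* The last condition says that the orientation is positive on a smooth local
   frame around every point. *)
Record manifold_orientation (R : realType) (n : nat) (M : manifold R n) :=
  ManifoldOrientation {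
  orientation_at :> forall x : M, set (n.-tuple (tangent x));
  orientation_atP : forall x : M,
    is_orientation (fullv : {vspace tangent x}) (@orientation_at x);
  orientation_continuous : forall x0 : M, exists U : set M,
    exists X : 'I_n -> forall x : M, tangent x,
      [/\ open U, U x0, forall i, smooth_vector_field_on U (X i) &
          forall x, U x -> @orientation_at x [tuple X i x | i < n]] }.

(** * G2-structures *)

(* [dx i j k] is the 3-form dx_ijk, with coordinates numbered from 1. *)
Definition dx {R : realType} (i j k : nat) (u v w : 'rV[R]_7) : R :=
  \det (\matrix_(a < 3, b < 3)
          tnth [tuple u; v; w] b 0 (inord (tnth [tuple i; j; k] a).-1)).

Definition phi0 {R : realType} (u v w : 'rV[R]_7) : R :=
  dx 1 2 3 u v w + dx 1 4 5 u v w + dx 1 6 7 u v w + dx 2 4 6 u v w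
  - dx 2 5 7 u v w - dx 3 4 7 u v w - dx 3 5 6 u v w.

Record g2_structure (R : realType) (M : manifold R 7) := G2Structure {
  g2_form :> forall x : M, tangent x -> tangent x -> tangent x -> R;
  g2_form_smooth : smooth_3tensor g2_form;
  g2_form_model : forall x : M, exists A : {linear tangent x -> 'rV[R]_7},
    bijective A /\
    forall u v w, g2_form u v w = phi0 (A u) (A v) (A w) }.

Section G2.
Context {R : realType} {M : manifold R 7} (phi : g2_structure M).

Definition g2_frame (x : M) : {linear tangent x -> 'rV[R]_7} :=
  projT1 (cid (g2_form_model phi x)).

(* The metric transported from R^7; it does not depend on the identification,
   since G2 is contained in SO(7). *)
Definition g2_metric (x : M) (u v : tangent x) : R :=
  \sum_(i < 7) g2_frame x u 0 i * g2_frame x v 0 i.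

Definition associative (x : M) (P : {vspace tangent x})
    (o : set (3.-tuple (tangent x))) : Prop :=
  is_orientation P o /\
  forall u v w, u \in P -> v \in P -> w \in P ->
    phi x u v w = volume_form (@g2_metric x) o u v w.

End G2.

Record associative_distribution (R : realType) (M : manifold R 7)
    (phi : g2_structure M) := AssociativeDistribution {
  distr :> forall x : M, {vspace tangent x};
  distr_dim : forall x, \dim (distr x) = 3%N;
  distr_smooth : forall x0 : M, exists U : set M,
    exists X : 'I_3 -> forall x : M, tangent x,
      [/\ open U, U x0, forall i, smooth_vector_field_on U (X i) &
          forall x, U x -> distr x = <<[tuple X i x | i < 3]>>%VS];
  distr_associative : forall x : M, exists o, associative phi (distr x) o }.

(** * Adiabatic geometry of an associative distribution *)

Section Adiabatic.
Context {R : realType} {M : manifold R 7} (phi : g2_structure M)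
  (H : associative_distribution phi).

(* The orientation making [H x] associative; it is unique. *)
Definition H_orientation (x : M) : set (3.-tuple (tangent x)) :=
  projT1 (cid (distr_associative H x)).

Definition Vspace (x : M) : set (tangent x) :=
  [set v | forall h, h \in H x -> g2_metric phi v h = 0].

Definition pH (x : M) (v : tangent x) : tangent x :=
  xget 0 [set h | h \in H x /\ Vspace (v - h)].

Definition pV (x : M) (v : tangent x) : tangent x := v - pH v.

Definition lambda_form (x : M) (u v w : tangent x) : R :=
  volume_form (@g2_metric _ _ phi x) (@H_orientation x) (pH u) (pH v) (pH w).

Definition omega_form (x : M) (u v w : tangent x) : R :=
  phi x u v w - lambda_form u v w.

(* The metric g^H_pi is the restriction of [gH] to pi. *)
Definition gH (x : M) (u v : tangent x) : R := g2_metric phi (pH u) (pH v).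

(* The vertical energy; the choice of the [gH]-orthonormal basis is
   irrelevant. *)
Definition vertical_energy (x : M) (P : {vspace tangent x}) : R :=
  let e : 3.-tuple (tangent x) :=
    xget (nseq_tuple 3 0)
      [set e : 3.-tuple (tangent x) |
         basis_of P e /\ orthonormal_family (@gH x) e] in
  2^-1 * \sum_(i < 3) g2_metric phi (pV (tnth e i)) (pV (tnth e i)).

(* J_h v for [v] in V_x; it is the Riesz representative of
   phi(h, v, .) restricted to V_x. *)
Definition J (x : M) (h v : tangent x) : tangent x :=
  xget 0 [set w | Vspace w /\
    forall w', Vspace w' -> g2_metric phi w w' = phi x h v w'].

Section Maps.
Context {S : manifold R 3} (gS : riemannian_metric S)
  (oS : manifold_orientation S) (iota : S -> M).

Definition tangent_mapH (s : S) (v : tangent s) : tangent (iota s) :=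
  pH (tangent_map iota s v).

Definition tangent_mapV (s : S) (v : tangent s) : tangent (iota s) :=
  pV (tangent_map iota s v).

Definition positive_horizontally_projectable : Prop :=
  forall s : S,
    [/\ injective (@tangent_mapH s),
        forall h, (h \in H (iota s)) <-> (exists v, tangent_mapH v = h) &
        forall e : 3.-tuple (tangent s), oS s e ->
          H_orientation (map_tuple (@tangent_mapH s) e)].

Definition horizontal_isometry : Prop :=
  forall (s : S) (u v : tangent s),
    g2_metric phi (tangent_mapH u) (tangent_mapH v) = gS s u v.

Definition tangent_plane (s : S) : {vspace tangent (iota s)} :=
  limg (linfun (tangent_map iota s)).

Definition tangent_plane_orientation (s : S) :
    set (3.-tuple (tangent (iota s))) :=
  map_tuple (tangent_map iota s) @` oS s.

Definition adiabatic_calibrated : Prop :=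
  forall (s : S) (u v w : tangent (iota s)),
    u \in tangent_plane s -> v \in tangent_plane s -> w \in tangent_plane s ->
    omega_form u v w =
      vertical_energy (tangent_plane s) *
      volume_form (@gH (iota s)) (@tangent_plane_orientation s) u v w.

Definition fueter_operator (I : forall s : S, tangent s -> tangent (iota s))
    (s : S) : tangent (iota s) :=
  let e := positive_onb (gS s) (oS s) in
  \sum_(i < 3) J (I s (tnth e i)) (tangent_mapV (tnth e i)).

Definition fueter_map (I : forall s : S, tangent s -> tangent (iota s)) : Prop :=
  forall s, fueter_operator I s = 0.

End Maps.
End Adiabatic.

(* Main.v *)
Require Import Defs.
From mathcomp Require Import all_boot all_order all_algebra.
From mathcomp Require Import all_classical all_reals all_analysis.
From mathcomp Require Import ring lra.

(** Fix a point of the domain, a positive orthonormal basis e_i of its tangent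
    space, and let w_i be the image of e_i under the differential, with
    horizontal part h_i and vertical part v_i. Since the horizontal part of
    the differential is an oriented isometry, the h_i form a positive
    orthonormal basis of the associative space H, and phi(h_1, h_2, h_3) = 1.
    The theorem follows from the energy identity [fueter_norm],

      |F|^2 = 2 (ve(pi) - omega(w_1, w_2, w_3)),

    where F = sum_i J_i(v_i) is the Fueter operator: F vanishes if and only if
    omega and ve vol^H agree on (w_1, w_2, w_3), because vol^H(w_1, w_2, w_3)
    = 1, and two alternating 3-forms on the 3-dimensional plane pi agree if
    they agree on one basis ([calibrated_on_tangent_frame]).

    The identity is pure algebra of the cross product u x v of R^7 defined by
    <u x v, w> = phi0(u, v, w), from the fact that phi0 is alternating and the
    quadratic relation [dot_cross_cross]. An associative orthonormal triple
    satisfies h_1 x h_2 = h_3 and cyclically ([cross_eq_of_phi0]), and J_i is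
    the cross product with h_i on V. Hence |J_i(v_i)| = |v_i|, and the relation
    gives <J_1(v_1), J_2(v_2)> = - phi0(h_3, v_1, v_2) and cyclically, so that
    |F|^2 is 2 ve minus twice the cyclic sum of phi0(h_i, v_j, v_k)
    ([dot_fueter]). On the other hand phi0(w_1, w_2, w_3) is 1 plus this same
    sum ([phi0_graph]), because phi0 vanishes on two vectors of H and one of
    V, and on three vectors of V ([phi0_normal]).

    The metric, projections, volume forms and energies are defined by choosing
    bases or vectors. A chosen positive orthonormal basis exists by
    Gram-Schmidt ([posdef_congruent_1]), and two choices differ by an orthogonal
    change of basis that alters neither volume forms ([volume_form_onb]) nor
    energies ([trace_orthogonal_change]). *)

Set Implicit Arguments.
Unset Strict Implicit.
Unset Printing Implicit Defensive.

Import Order.TTheory GRing.Theory Num.Theory.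

Local Open Scope ring_scope.

(** * The standard 3-form and its cross product *)

(** The rows of [B] are pairwise orthogonal and anisotropic, hence a basis of
    the whole space; an [a] orthogonal to all of them vanishes. *)
Lemma orthogonal_rows_separate (F : fieldType) n (B : 'M[F]_n)
    (a d : 'rV[F]_n) :
  B *m B^T = diag_mx d -> (forall i, d 0 i != 0) -> a *m B^T = 0 -> a = 0.
Proof.
move=> BB d0 aB; have : B^T \in unitmx.
  have : \det (B *m B^T) != 0 by rewrite BB det_diag; apply/prodf_neq0.
  by rewrite det_mulmx mulf_eq0 negb_or unitmxE unitfE => /andP[].
by move=> Bu; rewrite -(mulmxK Bu a) aB mul0mx.
Qed.

Section StandardForm.
Context {R : realType}.
Implicit Types u v w z : 'rV[R]_7.

Definition dot u v : R := \sum_(i < 7) u 0 i * v 0 i.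

Definition cross u v : 'rV[R]_7 := \row_k phi0 u v (delta_mx 0 k).

Lemma dotE u v : dot u v =
  u 0 (inord 0) * v 0 (inord 0) + u 0 (inord 1) * v 0 (inord 1)
  + u 0 (inord 2) * v 0 (inord 2) + u 0 (inord 3) * v 0 (inord 3)
  + u 0 (inord 4) * v 0 (inord 4) + u 0 (inord 5) * v 0 (inord 5)
  + u 0 (inord 6) * v 0 (inord 6).
Proof.
rewrite /dot (eq_bigr (fun i : 'I_7 => u 0 (inord i) * v 0 (inord i)));
  last by move=> i _; rewrite inord_val.
by rewrite !big_ord_recr big_ord0 /= add0r.
Qed.

Lemma dxE (i j k : nat) u v w : dx i j k u v w =
  let U n : R := u 0 (inord n.-1) in
  let V n : R := v 0 (inord n.-1) in
  let W n : R := w 0 (inord n.-1) in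
  U i * (V j * W k - W j * V k) - V i * (U j * W k - W j * U k)
  + W i * (U j * V k - V j * U k).
Proof.
rewrite /dx (expand_det_row _ ord0) !big_ord_recl big_ord0 /cofactor /=.
rewrite !(expand_det_row _ ord0) !big_ord_recl !big_ord0 /cofactor /=.
by rewrite !det_mx11 !mxE /tnth /=; ring.
Qed.

Lemma delta_inordE (i j : nat) : (i < 7)%N -> (j < 7)%N ->
  (delta_mx 0 (inord i) : 'rV[R]_7) 0 (inord j) = (i == j)%:R.
Proof. by move=> i7 j7; rewrite mxE eqxx -val_eqE /= !inordK // eq_sym. Qed.

Definition minor u v (i j : nat) : R :=
  u 0 (inord i) * v 0 (inord j) - u 0 (inord j) * v 0 (inord i).

(** With 0-based indices, one row per coordinate: each term dx_ijk of [phi0]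
    contributes one minor to each of the coordinates i, j and k. *)
Lemma crossE u v k : (k < 7)%N ->
  cross u v 0 (inord k) = nth 0 [::
    minor u v 1 2 + minor u v 3 4 + minor u v 5 6;
    minor u v 2 0 + minor u v 3 5 - minor u v 4 6;
    minor u v 0 1 - minor u v 3 6 - minor u v 4 5;
    minor u v 4 0 + minor u v 5 1 - minor u v 6 2;
    minor u v 0 3 - minor u v 6 1 - minor u v 5 2;
    minor u v 6 0 + minor u v 1 3 - minor u v 2 4;
    minor u v 0 5 - minor u v 1 4 - minor u v 2 3] k.
Proof.
move=> k7; rewrite mxE /phi0 !dxE /= !delta_inordE //.
move: k k7; do 7![case=> [_|]; first by rewrite /= /minor; ring].
by [].
Qed.

Lemma phi0E u v w : phi0 u v w = dot (cross u v) w.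
Proof.
rewrite dotE !crossE /minor //= /phi0 !dxE /=; ring.
Qed.

(** Polarization of |u x v|^2 = |u|^2 |v|^2 - <u, v>^2 in both arguments; the
    quadratic identity that makes [cross] a cross product, and the source of the
    Clifford relations between the complex structures J_h. *)
Lemma dot_cross_cross u v w z :
  dot (cross u v) (cross w z) + dot (cross w v) (cross u z) =
  2 * dot u w * dot v z - dot u v * dot w z - dot w v * dot u z.
Proof.
rewrite !dotE !crossE /minor //=; ring.
Qed.

Lemma dotC u v : dot u v = dot v u.
Proof. by apply: eq_bigr => i _; rewrite mulrC. Qed.

Lemma dot_linearl a u v w : dot (a *: u + v) w = a * dot u w + dot v w.
Proof.
rewrite /dot mulr_sumr -big_split; apply: eq_bigr => i _.
by rewrite !mxE mulrDl mulrA.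
Qed.

Lemma dotDl u v w : dot (u + v) w = dot u w + dot v w.
Proof. by rewrite -[u]scale1r dot_linearl scale1r mul1r. Qed.

Lemma dotDr u v w : dot w (u + v) = dot w u + dot w v.
Proof. by rewrite dotC dotDl !(dotC w). Qed.

Lemma dotNl u v : dot (- u) v = - dot u v.
Proof. by rewrite /dot -sumrN; apply: eq_bigr => i _; rewrite mxE mulNr. Qed.

Lemma dotNr u v : dot u (- v) = - dot u v.
Proof. by rewrite dotC dotNl dotC. Qed.

Lemma dotZl a u v : dot (a *: u) v = a * dot u v.
Proof.
by rewrite /dot mulr_sumr; apply: eq_bigr => i _; rewrite !mxE mulrA.
Qed.

Lemma dot0r u : dot u 0 = 0.
Proof. by rewrite /dot big1// => i _; rewrite mxE mulr0. Qed.

Lemma dot_eq0 u : (dot u u == 0) = (u == 0).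
Proof.
apply/eqP/eqP=> [/eqP|->]; last exact: dot0r.
rewrite psumr_eq0 => [/allP u0|i _]; last by rewrite -expr2 sqr_ge0.
apply/rowP=> i; rewrite mxE; apply/eqP.
by have := u0 i (mem_index_enum _); rewrite -expr2 sqrf_eq0.
Qed.

Lemma phi0_cycle u v w : phi0 u v w = phi0 v w u.
Proof. rewrite /phi0 !dxE /=; ring. Qed.

Lemma phi0C u v w : phi0 u v w = - phi0 v u w.
Proof. rewrite /phi0 !dxE /=; ring. Qed.

Lemma crossC u v : cross u v = - cross v u.
Proof. by apply/rowP=> k; rewrite !mxE phi0C. Qed.

Lemma phi0Dr u v w z : phi0 u v (w + z) = phi0 u v w + phi0 u v z.
Proof. by rewrite !phi0E dotDr. Qed.

Lemma phi0D u1 v1 u2 v2 u3 v3 : phi0 (u1 + v1) (u2 + v2) (u3 + v3) =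
  phi0 u1 u2 u3 + (phi0 u1 u2 v3 + phi0 u2 u3 v1 + phi0 u3 u1 v2)
  + (phi0 u1 v2 v3 + phi0 u2 v3 v1 + phi0 u3 v1 v2) + phi0 v1 v2 v3.
Proof.
have Dl u v w z : phi0 (u + v) w z = phi0 u w z + phi0 v w z.
  by rewrite phi0_cycle phi0Dr -!(phi0_cycle _ w z).
have Dm u v w z : phi0 w (u + v) z = phi0 w u z + phi0 w v z.
  by rewrite phi0_cycle Dl -(phi0_cycle w u z) -(phi0_cycle w v z).
rewrite !(Dl, Dm, phi0Dr).
rewrite (phi0_cycle u2 u3 v1) (phi0_cycle u3 v1 u2).
rewrite (phi0_cycle u3 u1 v2) (phi0_cycle u2 v3 v1) (phi0_cycle v3 v1 u2).
by rewrite (phi0_cycle u3 v1 v2); lra.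
Qed.

Lemma dot_cross_crossr u v w : dot (cross u v) (cross w v) =
  dot u w * dot v v - dot u v * dot w v.
Proof. have := dot_cross_cross u v w v; rewrite (dotC (cross w v)); lra. Qed.

Lemma dot_cross_self u v : dot v (cross u v) = 0.
Proof.
rewrite dotC -phi0E; have := phi0C u v v.
by have := phi0_cycle u v v; have := phi0_cycle v v u; lra.
Qed.

(** The equality case of phi0(u, v, w) <= |u x v| |w|: here [u], [v] and [w]
    are unit vectors and |u x v| = 1, so |u x v - w|^2 = 1 - 2 + 1. *)
Lemma cross_eq_of_phi0 u v w : dot u u = 1 -> dot v v = 1 -> dot u v = 0 ->
  dot w w = 1 -> phi0 u v w = 1 -> cross u v = w.
Proof.
move=> uu vv uv ww p; apply/eqP; rewrite -subr_eq0 -dot_eq0; apply/eqP.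
rewrite !(dotDl, dotDr, dotNl, dotNr) (dotC w) -(phi0E u v w) p ww.
by rewrite dot_cross_crossr uu vv uv; lra.
Qed.

Section AssociativeTriple.
Variables h1 h2 h3 : 'rV[R]_7.
Hypotheses (h11 : dot h1 h1 = 1) (h22 : dot h2 h2 = 1) (h33 : dot h3 h3 = 1).
Hypotheses (h12 : dot h1 h2 = 0) (h23 : dot h2 h3 = 0) (h31 : dot h3 h1 = 0).
Hypothesis h123 : phi0 h1 h2 h3 = 1.

Definition normal_to v := [/\ dot h1 v = 0, dot h2 v = 0 & dot h3 v = 0].

Lemma cross12 : cross h1 h2 = h3.
Proof. exact: cross_eq_of_phi0. Qed.
Lemma cross23 : cross h2 h3 = h1.
Proof. by apply: cross_eq_of_phi0 => //; rewrite -phi0_cycle. Qed.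
Lemma cross31 : cross h3 h1 = h2.
Proof. by apply: cross_eq_of_phi0 => //; rewrite -phi0_cycle -phi0_cycle. Qed.

(** The associative subspace is closed under [cross], and [cross h] is
    skew-adjoint; hence it preserves the orthogonal complement. *)
Lemma normal_cross v : normal_to v ->
  [/\ normal_to (cross h1 v), normal_to (cross h2 v) & normal_to (cross h3 v)].
Proof.
move=> [p1 p2 p3].
have flip x y : dot x (cross y v) = dot (cross x y) v.
  by rewrite dotC -!phi0E phi0_cycle phi0_cycle.
have hs h : dot h (cross h v) = 0 by rewrite crossC dotNr dot_cross_self oppr0.
rewrite /normal_to !hs !flip cross12 cross23 cross31.
rewrite (crossC h2 h1) (crossC h3 h2) (crossC h1 h3) cross12 cross23 cross31.
by rewrite !dotNl p1 p2 p3 oppr0.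
Qed.

(** The orthogonal complement of an associative subspace is coassociative.
    If v1 <> 0 then the h_i, v1 and the h_i x v1 are seven orthogonal vectors,
    so a basis, and v1 x v2 is orthogonal to the last four of them, thus lies in
    the span of the h_i, which is orthogonal to v3. *)
Lemma phi0_normal v1 v2 v3 : normal_to v1 -> normal_to v2 -> normal_to v3 ->
  phi0 v1 v2 v3 = 0.
Proof.
move=> [p1 p2 p3] [q1 q2 q3] [r1 r2 r3].
have [->|v1N0] := eqVneq v1 0; first by rewrite phi0_cycle phi0E dot0r.
set a := cross v1 v2.
set b := [:: h1; h2; h3; v1; cross h1 v1; cross h2 v1; cross h3 v1].
(* The component of v1 x v2 orthogonal to the h_i. *)
set a' := a - (dot h1 a *: h1 + dot h2 a *: h2 + dot h3 a *: h3).
suff : a' = 0.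
  move=> /subr0_eq; rewrite phi0E -/a => ->.
  by rewrite !dotDl !dotZl r1 r2 r3; lra.
have [[_ b1 a3] [a1 _ b2] [b3 a2 _]] := normal_cross (And3 p1 p2 p3).
have hs h : dot h (cross h v1) = 0 by rewrite crossC dotNr dot_cross_self oppr0.
have aJ h : dot h v1 = 0 -> dot h v2 = 0 -> dot a (cross h v1) = 0.
  move=> hv1 hv2; rewrite /a (crossC v1) dotNl dot_cross_crossr.
  by rewrite !(dotC _ h) hv1 hv2; lra.
have av1 : dot a v1 = 0 by rewrite /a dotC crossC dotNr dot_cross_self oppr0.
pose c := dot v1 v1.
have c0 : c != 0 by rewrite dot_eq0.
apply: (@orthogonal_rows_separate _ 7 (\matrix_(i < 7) nth 0 b i) _
          (\row_(i < 7) nth 0 [:: 1; 1; 1; c; c; c; c] i)).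
- have orth : pairwise (fun x y => dot x y == 0) b.
    rewrite /b /= !dot_cross_crossr (dotC h1 h3) h12 h23 h31 a1 a2 a3 b1 b2 b3.
    rewrite !hs !dot_cross_self p1 p2 p3 !mul0r !subr0 !eqxx.
    by [].
  apply/matrixP=> i j; rewrite !mxE.
  transitivity (dot (nth 0 b i) (nth 0 b j)).
    by apply: eq_bigr => k _; rewrite !mxE.
  have [->|] := eqVneq i j.
    by case: j => [[|[|[|[|[|[|[|//]]]]]]] ?] /=; rewrite ?dot_cross_crossr
       mulr1n ?h11 ?h22 ?h33 ?p1 ?p2 ?p3 ?mul1r ?mul0r ?subr0.
  rewrite -val_eqE /= mulr0n; case: ltngtP => // ij _.
    by apply/eqP; apply: (pairwiseP 0 orth) => //; apply: ltn_ord.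
  by rewrite dotC; apply/eqP; apply: (pairwiseP 0 orth) => //; apply: ltn_ord.
- move=> [i i7]; rewrite mxE /=.
  by do 7![case: i i7 => [_|i i7] /=; first by rewrite ?oner_eq0].
- apply/rowP=> i; rewrite !mxE; transitivity (dot a' (nth 0 b i)).
    by apply: eq_bigr => k _; rewrite !mxE.
  have : all (fun x => dot a' x == 0) b.
    rewrite /b /= /a' !(dotDl, dotNl, dotZl).
    rewrite !aJ // av1 a1 a2 a3 b1 b2 b3 !hs p1 p2 p3 h11 h22 h33.
    rewrite (dotC h3 h2) (dotC h2 h1) (dotC h1 h3) h12 h23 h31 !(dotC a).
    rewrite !(mulr0, mulr1, addr0, add0r) !subrr oppr0 eqxx.
    by [].
  by move=> /(all_nthP 0)/(_ i (ltn_ord i))/eqP.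
Qed.

Section Graph.
Variables v1 v2 v3 : 'rV[R]_7.
Hypotheses (nv1 : normal_to v1) (nv2 : normal_to v2) (nv3 : normal_to v3).

(** Among the eight terms of the expansion, those with two h_i vanish because
    h_i x h_j is some h_k, and the one without any h_i by coassociativity. *)
Lemma phi0_graph : phi0 (h1 + v1) (h2 + v2) (h3 + v3) =
  1 + (phi0 h1 v2 v3 + phi0 h2 v3 v1 + phi0 h3 v1 v2).
Proof.
move: (nv1) (nv2) (nv3) => [p1 p2 p3] [q1 q2 q3] [r1 r2 r3].
rewrite phi0D (@phi0_normal v1 v2 v3) // h123.
rewrite !(phi0E _ _ v1, phi0E _ _ v2, phi0E _ _ v3).
by rewrite cross12 cross23 cross31 p1 q2 r3; lra.
Qed.

(** As h_i is a unit vector orthogonal to v_i, h_i x v_i has the length of v_i;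
    the mixed products are <h1 x v1, h2 x v2> = - phi0(h3, v1, v2) and its
    cyclic permutations, which add up to the right-hand side of [phi0_graph]. *)
Lemma dot_fueter (f := cross h1 v1 + cross h2 v2 + cross h3 v3) :
  dot f f = dot v1 v1 + dot v2 v2 + dot v3 v3
    - 2 * (phi0 (h1 + v1) (h2 + v2) (h3 + v3) - 1).
Proof.
move: (nv1) (nv2) (nv3) => [p1 p2 p3] [q1 q2 q3] [r1 r2 r3].
have mixed h h' v v' :
    dot h v = 0 -> dot h v' = 0 -> dot h' v' = 0 -> dot h h' = 0 ->
    dot (cross h v) (cross h' v') = - phi0 (cross h h') v v'.
  move=> hv hv' h'v' hh'; have := dot_cross_cross h v v' h'.
  rewrite hv hv' hh' (dotC v' h') h'v' phi0_cycle phi0E.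
  by rewrite (crossC v v') (crossC h' v') dotNl dotNr; lra.
have self h v : dot h h = 1 -> dot h v = 0 ->
    dot (cross h v) (cross h v) = dot v v.
  by move=> hh hv; rewrite dot_cross_crossr hh hv; lra.
rewrite phi0_graph /f !(dotDl, dotDr) !self //.
rewrite (dotC (cross h2 v2) (cross h1 v1)) (dotC (cross h3 v3) (cross h2 v2)).
rewrite (dotC (cross h1 v1) (cross h3 v3)).
by rewrite !mixed // cross12 cross23 cross31; lra.
Qed.
End Graph.

End AssociativeTriple.
End StandardForm.

(** * Orthonormal bases, orientations and volume forms *)

(** The matrix form of Gram-Schmidt: if [G] is the Gram matrix of a basis, the
    rows of [P] are the coordinates of an orthonormal basis with the same
    orientation.  The induction eliminates the first basis vector and goes on
    with the Schur complement of the corner entry of [G]. *)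
Lemma posdef_congruent_1 (R : rcfType) n (G : 'M[R]_n) :
  G^T = G -> (forall x : 'rV_n, x != 0 -> 0 < (x *m G *m x^T) 0 0) ->
  exists2 P : 'M[R]_n, 0 < \det P & P *m G *m P^T = 1%:M.
Proof.
elim: n G => [|n IH].
  by move=> G _ _; exists 1%:M; [rewrite det1 ltr01 | apply/matrixP=> -[]].
rewrite -[n.+1]/(1 + n)%N => G; rewrite -[G]submxK.
rewrite [ulsubmx G]mx11_scalar; set a := ulsubmx G 0 0.
set b := ursubmx G; set c := dlsubmx G; set D := drsubmx G.
rewrite tr_block_mx => /eq_block_mx[_ cE _ DE] Gpos.
have a_gt0 : 0 < a.
  have := Gpos (row_mx 1%:M 0); rewrite mul_row_block tr_row_mx mul_row_col.
  rewrite !mul0mx !mul1mx trmx0 mulmx0 !addr0 trmx1 mulmx1 mxE eqxx mulr1n; apply.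
  apply/eqP=> /(congr1 lsubmx); rewrite row_mxKl => /matrixP/(_ 0 0).
  by rewrite !mxE eqxx => /eqP; rewrite oner_eq0.
have aN0 : a != 0 by rewrite gt_eqF.
(* The Schur complement: the Gram matrix of the other basis vectors after
   projection to the orthogonal complement of the first. *)
pose D' := D - a^-1 *: (c *m b).
have [||Q Qpos QE] := IH D'.
- by rewrite /D' linearB linearZ /= trmx_mul DE -cE trmxK.
(* The coefficient - x c / a minimizes the quadratic form over the vectors
   extending [x], and the minimum is the Schur complement at [x]. *)
- move=> x x0; have := Gpos (row_mx (- a^-1 *: (x *m c)) x).
  rewrite mul_row_block tr_row_mx mul_row_col mul_mx_scalar scalerA mulrN divff//.
  rewrite scaleN1r addNr mul0mx add0r.
  have -> : - a^-1 *: (x *m c) *m b + x *m D = x *m D'.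
    by rewrite -scalemxAl scaleNr addrC mulmxBr -scalemxAr mulmxA.
  apply; apply: contra_neq x0 => /(congr1 rsubmx); rewrite row_mxKr => ->.
  by apply/matrixP=> i j; rewrite !mxE.
exists (block_mx (Num.sqrt a)^-1%:M 0 (- a^-1 *: (Q *m c)) Q).
  by rewrite det_lblock det_scalar1 mulr_gt0// invr_gt0 sqrtr_gt0.
rewrite mulmx_block tr_block_mx mulmx_block !mul0mx !addr0.
have -> : (- a^-1 *: (Q *m c)) *m a%:M + Q *m c = 0.
  by rewrite mul_mx_scalar scalerA mulrN divff// scaleN1r addNr.
have -> : - a^-1 *: (Q *m c) *m b + Q *m D = Q *m D'.
  by rewrite -scalemxAl scaleNr addrC mulmxBr -scalemxAr mulmxA.
rewrite !(mul0mx, trmx0, mulmx0, addr0, add0r) QE.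
rewrite tr_scalar_mx -!scalar_mxM linearZ /= trmx_mul -cE.
have sN0 : Num.sqrt a != 0 by rewrite sqrtr_eq0 -ltNge.
rewrite [1%:M in RHS]scalar_mx_block; congr block_mx.
  by rewrite -{2}(sqr_sqrtr (ltW a_gt0)) expr2 mulKf// divff.
by rewrite !mul_scalar_mx scalerA mulrN mulfK// scaleNr -scalemxAl addrC subrr.
Qed.

Section BilinearForms.
Context {R : realType} {V : vectType R}.
Implicit Types (g : V -> V -> R) (n : nat).

Definition symmetric_bilinear g : Prop :=
  (forall a u v w, g (a *: u + v) w = a * g u w + g v w) /\
  (forall u v, g u v = g v u).

Definition gram g n (e : n.-tuple V) : 'M[R]_n :=
  \matrix_(i, j) g (tnth e i) (tnth e j).

Definition change_basis n (P : 'M[R]_n) (e : n.-tuple V) : n.-tuple V :=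
  [tuple \sum_j P i j *: tnth e j | i < n].

Lemma tnth_change_basis n (P : 'M[R]_n) (e : n.-tuple V) i :
  tnth (change_basis P e) i = \sum_j P i j *: tnth e j.
Proof. by rewrite tnth_mktuple. Qed.

Lemma change_basisM n (P Q : 'M[R]_n) e :
  change_basis (P *m Q) e = change_basis P (change_basis Q e).
Proof.
apply/eq_from_tnth=> i; rewrite !tnth_change_basis.
under [RHS]eq_bigr do rewrite tnth_change_basis scaler_sumr.
rewrite exchange_big; apply: eq_bigr => k _; rewrite mxE scaler_suml.
by apply: eq_bigr => j _; rewrite scalerA.
Qed.

Lemma change_basis1 n (e : n.-tuple V) : change_basis 1%:M e = e.
Proof.
apply/eq_from_tnth=> i; rewrite tnth_change_basis (bigD1 i)//= big1 ?addr0.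
  by rewrite mxE eqxx scale1r.
by move=> j ji; rewrite mxE eq_sym (negPf ji) scale0r.
Qed.

Lemma orientation_classP n (e f : n.-tuple V) :
  orientation_class e f <->
  exists2 P : 'M[R]_n, 0 < \det P & f = change_basis P e.
Proof.
split=> [[P [P0 fE]]|[P P0 ->]].
  by exists P => //; apply/eq_from_tnth=> i; rewrite fE tnth_change_basis.
by exists P; split=> // i; rewrite tnth_change_basis.
Qed.

Lemma orientation_class_trans n (b e f : n.-tuple V) :
  orientation_class b e -> orientation_class b f ->
  exists2 P : 'M[R]_n, 0 < \det P & f = change_basis P e.
Proof.
move=> /orientation_classP[P P0 ->] /orientation_classP[Q Q0 ->].
have Pu : P \in unitmx by rewrite unitmxE unitfE gt_eqF.
exists (Q *m invmx P); last by rewrite -change_basisM mulmxKV.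
by rewrite det_mulmx det_inv divr_gt0.
Qed.

Lemma change_basis_in (W : {vspace V}) n (P : 'M[R]_n) (e : n.-tuple V) :
  (forall i, tnth e i \in W) -> forall i, tnth (change_basis P e) i \in W.
Proof.
by move=> eW i; rewrite tnth_change_basis memv_suml// => j _; rewrite memvZ.
Qed.

Lemma in_span_tnth n (e : n.-tuple V) i : tnth e i \in <<e>>%VS.
Proof. by rewrite memv_span// mem_tnth. Qed.

Lemma orientation_class_basis (W : {vspace V}) n (b e : n.-tuple V) :
  basis_of W b -> orientation_class b e -> basis_of W e.
Proof.
move=> bW /orientation_classP[P P0 eE].
have Pu : P \in unitmx by rewrite unitmxE unitfE gt_eqF.
have bE : b = change_basis (invmx P) e.
  by rewrite eE -change_basisM mulVmx// change_basis1.
rewrite basisEdim size_tuple (size_basis bW) leqnn andbT -(span_basis bW).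
apply/span_subvP => _ /tnthP[i ->]; rewrite bE.
by apply: change_basis_in => j; exact: in_span_tnth.
Qed.

Lemma basis_change_basis (W : {vspace V}) n (e f : n.-tuple V) :
  basis_of W e -> (forall i, tnth f i \in W) -> exists P, f = change_basis P e.
Proof.
move=> eW fW; exists (\matrix_(i, j) coord e j (tnth f i)).
apply/eq_from_tnth=> i; rewrite tnth_change_basis (coord_basis eW (fW i)).
by apply: eq_bigr => j _; rewrite mxE [tnth e j](tnth_nth 0).
Qed.

Section Gram.
Variable g : V -> V -> R.
Hypothesis gP : symmetric_bilinear g.

Lemma bilinear_subl u v w : g (u - v) w = g u w - g v w.
Proof. by rewrite addrC -scaleN1r gP.1 mulN1r addrC. Qed.

Lemma bilinear_suml n (c : 'I_n -> R) (e : 'I_n -> V) w :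
  g (\sum_i c i *: e i) w = \sum_i c i * g (e i) w.
Proof.
have [gl _] := gP.
have g0 : g 0 w = 0 by have := gl 1 0 0 w; rewrite scaler0 addr0 mul1r; lra.
by elim/big_rec2 : _ => // i x y _ <-; rewrite gl.
Qed.

Lemma bilinear_sumr n (c : 'I_n -> R) (e : 'I_n -> V) w :
  g w (\sum_i c i *: e i) = \sum_i c i * g w (e i).
Proof.
by have [_ gs] := gP; rewrite gs bilinear_suml; apply: eq_bigr => i _; rewrite gs.
Qed.

Lemma gram_change_basis n (P : 'M[R]_n) (e : n.-tuple V) :
  gram g (change_basis P e) = P *m gram g e *m P^T.
Proof.
apply/matrixP=> i k; rewrite mxE !tnth_change_basis bilinear_sumr mxE.
by apply: eq_bigr => j _; rewrite mulrC bilinear_suml !mxE; congr (_ * _);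
  apply: eq_bigr => l _; rewrite mxE.
Qed.

Lemma orthonormal_gram n (e : n.-tuple V) :
  orthonormal_family g e <-> gram g e = 1%:M.
Proof.
split=> [eo|/matrixP eo i j]; first by apply/matrixP=> i j; rewrite !mxE eo.
by have := eo i j; rewrite !mxE.
Qed.

Lemma orthonormal_family_free n (e : n.-tuple V) :
  orthonormal_family g e -> free e.
Proof.
move=> eo; apply/freeP => k k0 i.
have : g (\sum_j k j *: tnth e j) (tnth e i) = k i.
  rewrite bilinear_suml (bigD1 i)//= eo eqxx mulr1 big1 ?addr0// => j ji.
  by rewrite eo (negPf ji) mulr0.
under eq_bigr do rewrite (tnth_nth 0); rewrite k0 => <-.
by have [gl _] := gP; have := gl 1 0 0 (tnth e i); rewrite scaler0 addr0 mul1r; lra.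
Qed.

Lemma orthonormal_change n (e : n.-tuple V) (P : 'M[R]_n) :
  orthonormal_family g e -> orthonormal_family g (change_basis P e) ->
  P *m P^T = 1%:M.
Proof.
move=> /orthonormal_gram eo /orthonormal_gram.
by rewrite gram_change_basis eo mulmx1.
Qed.

Lemma oriented_onb_exists n (b : n.-tuple V) : free b ->
  (forall u, u != 0 -> 0 < g u u) ->
  exists e, orientation_class b e /\ orthonormal_family g e.
Proof.
move=> bfree gpos; have [||P P0 PE] := @posdef_congruent_1 R n (gram g b).
- by apply/matrixP=> i j; rewrite !mxE gP.2.
- move=> x x0; pose u := \sum_i x 0 i *: tnth b i.
  have -> : (x *m gram g b *m x^T) 0 0 = g u u.
    rewrite bilinear_sumr mxE; apply: eq_bigr => j _.
    rewrite mulrC bilinear_suml !mxE.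
    by congr (_ * _); apply: eq_bigr => i _; rewrite mxE.
  apply: gpos; apply: contra_neq x0 => u0; apply/rowP=> i; rewrite mxE.
  move/freeP: bfree => /(_ (fun i => x 0 i)); apply; rewrite -[RHS]u0.
  by apply: eq_bigr => j _; rewrite (tnth_nth 0).
exists (change_basis P b); split; first by apply/orientation_classP; exists P.
by apply/orthonormal_gram; rewrite gram_change_basis.
Qed.

Lemma positive_onbP n (o : set (n.-tuple V)) (e : n.-tuple V) :
  o e -> orthonormal_family g e ->
  o (positive_onb g o) /\ orthonormal_family g (positive_onb g o).
Proof.
move=> oe eo; exact: (@xgetPex _ (nseq_tuple n 0)
  [set e | o e /\ orthonormal_family g e]%classic (ex_intro _ e (conj oe eo))).
Qed.

Lemma volume_formE (o : set (3.-tuple V)) (e : 3.-tuple V) :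
  volume_form g o (tnth e 0) (tnth e 1) (tnth e 2) =
  \det (\matrix_(i, j) g (tnth (positive_onb g o) i) (tnth e j)).
Proof.
congr (\det _); apply/matrixP=> i j; rewrite !mxE; congr (g _ _).
by case: j => [[|[|[|//]]] ?]; rewrite (tnth_nth 0) /=; congr tnth; apply: val_inj.
Qed.

(** The alternating trilinear character of [volume_form], in the form needed to
    compare it with other 3-forms on the span of [e]. *)
Lemma volume_form_change_basis (o : set (3.-tuple V)) (e : 3.-tuple V)
    (P : 'M[R]_3) :
  let f := change_basis P e in
  volume_form g o (tnth f 0) (tnth f 1) (tnth f 2) =
  \det P * volume_form g o (tnth e 0) (tnth e 1) (tnth e 2).
Proof.
move=> f; rewrite !volume_formE mulrC -(det_tr P) -det_mulmx.
congr (\det _); apply/matrixP=> i j; rewrite !mxE tnth_change_basis bilinear_sumr.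
by apply: eq_bigr => k _; rewrite !mxE mulrC.
Qed.

(** Two orthonormal bases of the same orientation differ by an orthogonal matrix
    of positive determinant, hence of determinant 1; so the basis that
    [positive_onb] picks does not matter. *)
Lemma volume_form_onb (b e : 3.-tuple V) :
  orientation_class b e -> orthonormal_family g e ->
  volume_form g (orientation_class b) (tnth e 0) (tnth e 1) (tnth e 2) = 1.
Proof.
move=> be eo; have [bp po] := positive_onbP be eo.
have [P P0 eE] := orientation_class_trans bp be.
have PP : P *m P^T = 1%:M by apply: (orthonormal_change po); rewrite -eE.
rewrite eE volume_form_change_basis volume_formE.
have -> : \matrix_(i, j) g (tnth (positive_onb g (orientation_class b)) i)
    (tnth (positive_onb g (orientation_class b)) j) = 1%:M.
  exact/orthonormal_gram.
rewrite det1 mulr1.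
have /eqP := congr1 determinant PP; rewrite det_mulmx det_tr det1 -expr2.
by rewrite sqrf_eq1 => /orP[/eqP//|/eqP PN]; move: P0; rewrite PN oppr_gt0 ltr10.
Qed.

(** The sum is the trace of the Gram matrix; for the vertical part of the metric
    this makes the vertical energy independent of the orthonormal basis. *)
Lemma trace_orthogonal_change n (e : n.-tuple V) (P : 'M[R]_n) :
  P *m P^T = 1%:M ->
  \sum_i g (tnth (change_basis P e) i) (tnth (change_basis P e) i) =
  \sum_i g (tnth e i) (tnth e i).
Proof.
move=> /mulmx1C PP.
have trE f : \sum_i g (tnth f i) (tnth f i) = \tr (gram g f).
  by apply: eq_bigr => i _; rewrite mxE.
by rewrite !trE gram_change_basis mxtrace_mulC mulmxA PP mul1mx.
Qed.

End Gram.
End BilinearForms.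

Lemma tuple3_eta (T : Type) (e : 3.-tuple T) :
  e = [tuple tnth e 0; tnth e 1; tnth e 2].
Proof.
apply/eq_from_tnth => j.
by case: j => [[|[|[|//]]] ?]; rewrite [RHS](tnth_nth (tnth e 0)) /=;
  congr tnth; apply: val_inj.
Qed.

Lemma sum3E (V : nmodType) (F : 'I_3 -> V) : \sum_(i < 3) F i = F 0 + F 1 + F 2.
Proof.
rewrite !big_ord_recr big_ord0 /= add0r.
by congr (F _ + F _ + F _); apply: val_inj.
Qed.

Lemma linear_change_basis (R : realType) (V W : vectType R) (f : V -> W) n
    (P : 'M[R]_n) (e : n.-tuple V) i : linear f ->
  f (tnth (change_basis P e) i) = tnth (change_basis P (map_tuple f e)) i.
Proof.
move=> fl; have f0 : f 0 = 0 by have := fl (-1) 0 0; rewrite !scaleN1r !addNr.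
rewrite !tnth_change_basis.
by elim/big_rec2 : _ => // j x y _ <-; rewrite fl tnth_map.
Qed.

Lemma map_change_basis (R : realType) (V W : vectType R) (f : V -> W) n
    (P : 'M[R]_n) (e : n.-tuple V) : linear f ->
  map_tuple f (change_basis P e) = change_basis P (map_tuple f e).
Proof.
by move=> fl; apply/eq_from_tnth=> i; rewrite tnth_map linear_change_basis.
Qed.

Lemma map_orientation_class (R : realType) (V W : vectType R) (f : V -> W) n
    (b : n.-tuple V) : linear f ->
  (map_tuple f @` orientation_class b)%classic =
  orientation_class (map_tuple f b).
Proof.
move=> fl; apply/seteqP; split=> [_ [e /orientation_classP[P P0 ->] <-]|e].
  by apply/orientation_classP; exists P; rewrite ?map_change_basis.
move=> /orientation_classP[P P0 ->]; exists (change_basis P b).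
  by apply/orientation_classP; exists P.
by rewrite map_change_basis.
Qed.

(** Each dx_ijk is the determinant of a matrix of coordinates, on which the
    change of basis acts by multiplication. *)
Lemma phi0_change_basis (R : realType) (P : 'M[R]_3) (e : 3.-tuple 'rV[R]_7) :
  let f := change_basis P e in
  phi0 (tnth f 0) (tnth f 1) (tnth f 2) =
  \det P * phi0 (tnth e 0) (tnth e 1) (tnth e 2).
Proof.
move=> f.
have dxP i j k : dx i j k (tnth f 0) (tnth f 1) (tnth f 2) =
    \det P * dx i j k (tnth e 0) (tnth e 1) (tnth e 2).
  rewrite /dx -!tuple3_eta -det_tr mulrC -[in RHS]det_tr mulrC -det_mulmx.
  congr (\det _); apply/matrixP=> a b; rewrite !mxE tnth_change_basis summxE.
  by apply: eq_bigr => l _; rewrite !mxE.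
rewrite /phi0 !dxP; ring.
Qed.

(** * An associative subspace of a tangent space *)

Section Pointwise.
Context {R : realType} {M : manifold R 7} (phi : g2_structure M) (x : M).
Local Notation A := (g2_frame phi x).
Local Notation g := (@g2_metric R M phi x).

Lemma g2_frame_bij : bijective A.
Proof. by have [] := projT2 (cid (g2_form_model phi x)). Qed.

Lemma g2_formE u v w : phi x u v w = phi0 (A u) (A v) (A w).
Proof. by have [_] := projT2 (cid (g2_form_model phi x)). Qed.

Lemma g2_metricE u v : g u v = dot (A u) (A v).
Proof. by []. Qed.

Lemma g2_metric_bilinear : symmetric_bilinear g.
Proof.
split=> [a u v w|u v]; rewrite !g2_metricE; last exact: dotC.
by rewrite linearP dot_linearl.
Qed.

Lemma g2_metric_eq0 u : (g u u == 0) = (u == 0).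
Proof.
by rewrite g2_metricE dot_eq0 -[RHS](inj_eq (bij_inj g2_frame_bij)) linear0.
Qed.

Variable H : associative_distribution phi.

Lemma H_orientation_class : exists2 b : 3.-tuple (tangent x), basis_of (H x) b &
  @H_orientation R M phi H x = orientation_class b.
Proof. by have [] := projT2 (cid (distr_associative H x)). Qed.

Lemma phi_volume_on_H u v w : u \in H x -> v \in H x -> w \in H x ->
  phi x u v w = volume_form g (@H_orientation R M phi H x) u v w.
Proof. by have [_] := projT2 (cid (distr_associative H x)); apply. Qed.

Variable h : 3.-tuple (tangent x).
Hypothesis h_or : @H_orientation R M phi H x h.
Hypothesis h_on : orthonormal_family g h.
Local Notation V := (@Vspace R M phi H x).
Local Notation pHx := (@pH R M phi H x).
Local Notation pVx := (@pV R M phi H x).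

Lemma onb_basis_H : basis_of (H x) h.
Proof.
have [b bH oE] := H_orientation_class.
by apply: orientation_class_basis bH _; rewrite -oE.
Qed.

Lemma onb_in_H i : tnth h i \in H x.
Proof. by rewrite -(span_basis onb_basis_H); apply: in_span_tnth. Qed.

Lemma volume_form_H_onb : 
  volume_form g (@H_orientation R M phi H x) (tnth h 0) (tnth h 1) (tnth h 2) = 1.
Proof.
have [b bH oE] := H_orientation_class; rewrite oE.
by apply: volume_form_onb => //; [exact: g2_metric_bilinear | rewrite -oE].
Qed.

Lemma phi_H_onb : phi x (tnth h 0) (tnth h 1) (tnth h 2) = 1.
Proof. by rewrite phi_volume_on_H ?onb_in_H ?volume_form_H_onb. Qed.

Lemma phi0_H_onb : phi0 (A (tnth h 0)) (A (tnth h 1)) (A (tnth h 2)) = 1.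
Proof. by rewrite -g2_formE phi_H_onb. Qed.

Lemma VspaceP v : V v <-> forall i, g (tnth h i) v = 0.
Proof.
have [gl gs] := g2_metric_bilinear.
split=> [Vv i|hv u]; first by rewrite gs Vv ?onb_in_H.
rewrite -(span_basis onb_basis_H) => /coord_span ->.
rewrite (bilinear_sumr g2_metric_bilinear) big1 // => i _.
by rewrite -tnth_nth gs hv mulr0.
Qed.

Lemma Vspace_sub u v : V u -> V v -> V (u - v).
Proof.
by move=> Vu Vv w wH; rewrite (bilinear_subl g2_metric_bilinear) Vu// Vv// subrr.
Qed.

Lemma Vspace_sub_projection v : V (v - \sum_i g v (tnth h i) *: tnth h i).
Proof.
have gb := g2_metric_bilinear; apply/VspaceP => i.
rewrite gb.2 (bilinear_subl gb) (bilinear_suml gb) (bigD1 i)//= h_on eqxx mulr1.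
by rewrite big1 ?addr0 ?subrr// => j ji; rewrite h_on (negPf ji) mulr0.
Qed.

(** The vector chosen by [pH] exists because the sum is one, and is unique
    because a difference of two such vectors lies in both H and V. *)
Lemma pHE v : pHx v = \sum_i g v (tnth h i) *: tnth h i.
Proof.
set p := RHS.
have pH_ : p \in H x by rewrite memv_suml// => i _; rewrite memvZ// onb_in_H.
have pV_ : V (v - p) by exact: Vspace_sub_projection.
apply: xget_unique; first by split.
move=> y [yH yV]; apply/eqP; rewrite -subr_eq0 -g2_metric_eq0; apply/eqP.
have : V (y - p).
  have -> : y - p = (v - p) - (v - y) by rewrite opprB [RHS]addrC addrA subrK.
  exact: Vspace_sub.
by apply; rewrite memvB.
Qed.

Lemma pH_linear : linear pHx.
Proof.
move=> a u v; rewrite !pHE scaler_sumr -big_split; apply: eq_bigr => i _ /=.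
by have [gl _] := g2_metric_bilinear; rewrite gl scalerDl scalerA.
Qed.

Lemma pV_linear : linear pVx.
Proof.
by move=> a u v; rewrite /pV pH_linear scalerBr opprD addrACA.
Qed.

Lemma pV_Vspace v : V (pVx v).
Proof.
by rewrite /pV pHE; exact: Vspace_sub_projection.
Qed.

Lemma gH_bilinear : symmetric_bilinear (@gH R M phi H x).
Proof.
have [gl gs] := g2_metric_bilinear; rewrite /gH.
by split=> *; rewrite ?pH_linear ?gl.
Qed.

Lemma normal_of_Vspace v : V v ->
  normal_to (A (tnth h 0)) (A (tnth h 1)) (A (tnth h 2)) (A v).
Proof. by move=> /VspaceP Vv; split; exact: Vv. Qed.

Lemma Vspace_of_normal v :
  normal_to (A (tnth h 0)) (A (tnth h 1)) (A (tnth h 2)) (A v) -> V v.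
Proof.
move=> [n0 n1 n2]; apply/VspaceP => -[[|[|[|//]]] ?]; rewrite g2_metricE;
 [move: n0|move: n1|move: n2]; congr (dot (A (tnth _ _)) _ = 0); exact: val_inj.
Qed.

Lemma dot_H_onb i j : dot (A (tnth h i)) (A (tnth h j)) = (i == j)%:R.
Proof. exact: h_on. Qed.

(** In the model, J_h is the cross product with [h]: [phi0E] is the defining
    property of J_h, and [normal_cross] says that the product stays in V. *)
Lemma g2_frame_J i v : V v -> A (J H (tnth h i) v) = cross (A (tnth h i)) (A v).
Proof.
move=> Vv; have [B AB BA] := g2_frame_bij.
suff -> : J H (tnth h i) v = B (cross (A (tnth h i)) (A v)) by rewrite BA.
have [c0 c1 c2] := normal_cross
  (dot_H_onb 0 0) (dot_H_onb 1 1) (dot_H_onb 2 2)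
  (dot_H_onb 0 1) (dot_H_onb 1 2) (dot_H_onb 2 0)
  phi0_H_onb (normal_of_Vspace Vv).
have VJ : V (B (cross (A (tnth h i)) (A v))).
  apply: Vspace_of_normal; rewrite BA; case: i => [[|[|[|//]]] k].
  - have -> : Ordinal k = 0 by apply: val_inj.
    exact: c0.
  - have -> : Ordinal k = 1 by apply: val_inj.
    exact: c1.
  - have -> : Ordinal k = 2 by apply: val_inj.
    exact: c2.
apply: xget_unique => [|y [yV yJ]].
  by split=> // w' _; rewrite g2_metricE BA -phi0E g2_formE.
apply/eqP; rewrite -subr_eq0 -g2_metric_eq0; apply/eqP.
have Vd := Vspace_sub yV VJ.
rewrite (bilinear_subl g2_metric_bilinear) yJ// g2_metricE BA -phi0E g2_formE.
by rewrite subrr.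
Qed.

End Pointwise.

(** * The tangent plane of a horizontally isometric immersion *)

Section AtPoint.
Context {R : realType} {M : manifold R 7} (phi : g2_structure M)
    (H : associative_distribution phi) (S : manifold R 3)
    (gS : riemannian_metric S) (oS : manifold_orientation S) (iota : S -> M).
Hypothesis iota_positive : positive_horizontally_projectable H oS iota.
Hypothesis iota_isometry : horizontal_isometry H gS iota.
Variable s : S.
Local Notation A := (g2_frame phi (iota s)).
Local Notation g := (@g2_metric R M phi (iota s)).
Local Notation dH := (@tangent_mapH R M phi H S iota s).
Local Notation d := (tangent_map iota s).

Definition domain_onb : 3.-tuple (tangent s) := positive_onb (gS s) (oS s).
Definition tangent_frame : 3.-tuple (tangent (iota s)) :=
  map_tuple d domain_onb.
Definition horizontal_frame : 3.-tuple (tangent (iota s)) :=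
  map_tuple dH domain_onb.
Local Notation w := tangent_frame.
Local Notation h := horizontal_frame.

Lemma metric_bilinear : symmetric_bilinear (gS s).
Proof.
split=> [a u v z|u v]; first exact: (metric_linear gS).
exact: (Defs.metric_sym gS).
Qed.

(** Orthonormal bases exist in every orientation class, so the default value
    of [positive_onb] is never reached. *)
Lemma domain_onbP : oS s domain_onb /\ orthonormal_family (gS s) domain_onb.
Proof.
have [b bb oE] := orientation_atP oS s.
have [|e [be eo]] := oriented_onb_exists metric_bilinear (basis_free bb).
  exact: metric_posdef.
by apply: (positive_onbP (e := e)); rewrite ?oE.
Qed.

Lemma horizontal_frame_oriented : @H_orientation R M phi H (iota s) h.
Proof. by have [_ _] := iota_positive s; apply; case: domain_onbP. Qed.

Lemma horizontal_frame_orthonormal : orthonormal_family g h.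
Proof.
by move=> i j; rewrite !tnth_map iota_isometry; have [_ ->] := domain_onbP.
Qed.

Local Notation pH := (@pH R M phi H (iota s)).
Local Notation pV := (@pV R M phi H (iota s)).
Local Notation gH := (@gH R M phi H (iota s)).

Lemma pH_tangent_frame i : pH (tnth w i) = tnth h i.
Proof. by rewrite !tnth_map. Qed.

Lemma tangent_frame_orthonormal : orthonormal_family gH w.
Proof.
by move=> i j; rewrite /Defs.gH !pH_tangent_frame horizontal_frame_orthonormal.
Qed.

Let gHb := gH_bilinear horizontal_frame_oriented horizontal_frame_orthonormal.
Let pHl := pH_linear horizontal_frame_oriented horizontal_frame_orthonormal.
Let pVl := pV_linear horizontal_frame_oriented horizontal_frame_orthonormal.

Lemma tangent_frame_basis : basis_of (tangent_plane iota s) w.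
Proof.
have [b bb oE] := orientation_atP oS s.
have eb : basis_of fullv domain_onb.
  by apply: orientation_class_basis bb _; rewrite -oE; case: domain_onbP.
rewrite /basis_of (orthonormal_family_free gHb tangent_frame_orthonormal) andbT.
rewrite /tangent_plane -(span_basis eb) limg_span; apply/eqP; congr (span _).
by apply: eq_map => v; rewrite lfunE.
Qed.

Lemma volume_form_tangent_frame :
  volume_form gH (@tangent_plane_orientation R M S oS iota s)
    (tnth w 0) (tnth w 1) (tnth w 2) = 1.
Proof.
have [b bb oE] := orientation_atP oS s.
have dl : linear d by move=> a u v; rewrite linearP.
rewrite /tangent_plane_orientation oE map_orientation_class//.
apply: volume_form_onb; [exact: gHb| |exact: tangent_frame_orthonormal].
rewrite -map_orientation_class// -oE.
by exists domain_onb => //; case: domain_onbP.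
Qed.

Definition vertical_part i := pV (tnth w i).

Lemma vertical_energy_tangent_frame :
  vertical_energy H (tangent_plane iota s) =
    2^-1 * \sum_i g (vertical_part i) (vertical_part i).
Proof.
rewrite /vertical_energy; set e := xget _ _.
have [eb eo] : basis_of (tangent_plane iota s) e /\ orthonormal_family gH e.
  exact: (@xgetPex _ (nseq_tuple 3 0) [set e : 3.-tuple (tangent (iota s)) |
         basis_of (tangent_plane iota s) e /\ orthonormal_family gH e]%classic
         (ex_intro _ w (conj tangent_frame_basis tangent_frame_orthonormal))).
have [P eE] : exists P, e = change_basis P w.
  apply: basis_change_basis tangent_frame_basis _ => i.
  by rewrite -(span_basis eb); exact: in_span_tnth.
have PP : P *m P^T = 1%:M.
  by apply: (orthonormal_change gHb tangent_frame_orthonormal); rewrite -eE.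
have Bb : symmetric_bilinear (fun u v => g (pV u) (pV v)).
  have [gl gs] := g2_metric_bilinear phi (iota s).
  by split=> *; rewrite ?pVl ?gl.
by rewrite eE (trace_orthogonal_change Bb w PP).
Qed.

Lemma tangent_frame_split i : A (tnth w i) = A (tnth h i) + A (vertical_part i).
Proof.
by rewrite -linearD /vertical_part /Defs.pV -pH_tangent_frame addrC subrK.
Qed.

Lemma omega_change_basis (P : 'M[R]_3) : let f := change_basis P w in
  omega_form H (tnth f 0) (tnth f 1) (tnth f 2) =
  \det P * omega_form H (tnth w 0) (tnth w 1) (tnth w 2).
Proof.
move=> f; rewrite /omega_form /lambda_form mulrBr; congr (_ - _).
  rewrite !g2_formE !(linear_change_basis _ _ _ (linearP A)) phi0_change_basis.
  by rewrite !tnth_map.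
rewrite !(linear_change_basis _ _ _ pHl) volume_form_change_basis ?tnth_map//.
exact: g2_metric_bilinear.
Qed.

Lemma omega_tangent_frame : omega_form H (tnth w 0) (tnth w 1) (tnth w 2) =
  phi0 (A (tnth w 0)) (A (tnth w 1)) (A (tnth w 2)) - 1.
Proof.
rewrite /omega_form /lambda_form g2_formE !pH_tangent_frame.
rewrite volume_form_H_onb //; first exact: horizontal_frame_oriented.
exact: horizontal_frame_orthonormal.
Qed.

(** The energy identity |F|^2 = 2 (ve - omega) behind the theorem: [dot_fueter]
    with the h_i and v_i the horizontal and vertical parts of the tangent frame,
    on which the volume form of H takes the value 1. *)
Lemma fueter_norm
    (F := fueter_operator H gS oS (@tangent_mapH R M phi H S iota) s) :
  g F F = 2 * (vertical_energy H (tangent_plane iota s)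
               - omega_form H (tnth w 0) (tnth w 1) (tnth w 2)).
Proof.
have [ho hn] := (horizontal_frame_oriented, horizontal_frame_orthonormal).
have Vv i := pV_Vspace ho hn (tnth w i).
have FE : A F = \sum_i cross (A (tnth h i)) (A (vertical_part i)).
  rewrite /F /fueter_operator linear_sum; apply: eq_bigr => i _.
  by rewrite -(g2_frame_J ho hn i (Vv i)) /vertical_part !tnth_map.
rewrite g2_metricE FE vertical_energy_tangent_frame omega_tangent_frame.
rewrite !sum3E !tangent_frame_split.
rewrite (dot_fueter
  (dot_H_onb hn 0 0) (dot_H_onb hn 1 1) (dot_H_onb hn 2 2)
  (dot_H_onb hn 0 1) (dot_H_onb hn 1 2) (dot_H_onb hn 2 0) (phi0_H_onb ho hn)
  (normal_of_Vspace ho (Vv 0)) (normal_of_Vspace ho (Vv 1))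
  (normal_of_Vspace ho (Vv 2))).
by rewrite -!g2_metricE; lra.
Qed.

(** Both sides of the calibration condition are alternating trilinear on a
    3-dimensional plane, so they agree as soon as they agree on one basis; on
    the tangent frame the volume form is 1. *)
Lemma calibrated_on_tangent_frame :
  (forall u v z, u \in tangent_plane iota s -> v \in tangent_plane iota s ->
     z \in tangent_plane iota s -> omega_form H u v z =
       vertical_energy H (tangent_plane iota s) *
       volume_form gH (@tangent_plane_orientation R M S oS iota s) u v z) <->
  omega_form H (tnth w 0) (tnth w 1) (tnth w 2) =
    vertical_energy H (tangent_plane iota s).
Proof.
have wP i : tnth w i \in tangent_plane iota s.
  by rewrite -(span_basis tangent_frame_basis); exact: in_span_tnth.
split=> [/(_ _ _ _ (wP 0) (wP 1) (wP 2))->|wE u v z uP vP zP].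
  by rewrite volume_form_tangent_frame mulr1.
have [P fE] : exists P, [tuple u; v; z] = change_basis P w.
  apply: basis_change_basis tangent_frame_basis _ => -[[|[|[|//]]] ?];
    by rewrite (tnth_nth 0).
have -> : u = tnth (change_basis P w) 0 by rewrite -fE.
have -> : v = tnth (change_basis P w) 1 by rewrite -fE.
have -> : z = tnth (change_basis P w) 2 by rewrite -fE.
rewrite omega_change_basis volume_form_change_basis//.
by rewrite volume_form_tangent_frame wE; ring.
Qed.

End AtPoint.

Theorem theorem9p4 (R : realType) (M : manifold R 7) (phi : g2_structure M)
    (H : associative_distribution phi) (S : manifold R 3)
    (gS : riemannian_metric S) (oS : manifold_orientation S) (iota : S -> M)
    (iota_immersion : immersion iota)
    (iota_positive : positive_horizontally_projectable H oS iota)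
    (iota_isometry : horizontal_isometry H gS iota) :
  fueter_map H gS oS (@tangent_mapH R M phi H S iota) <->
  adiabatic_calibrated H oS iota.
Proof.
have at_point s := calibrated_on_tangent_frame iota_positive iota_isometry s.
have norm s := fueter_norm iota_positive iota_isometry s.
split=> [F0 s | cal s].
  have g00 : g2_metric phi (0 : tangent (iota s)) 0 = 0.
    by apply/eqP; rewrite g2_metric_eq0.
  by apply/at_point; have := norm s; rewrite /= (F0 s) g00; lra.
apply/eqP; rewrite -(g2_metric_eq0 phi) norm; move: (cal s) => /at_point ->.
by rewrite subrr mulr0.
Qed.
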